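(* Let $P=(X,\prec)$ be an interval order with $X=\{1,\dots,n\}$. The vector $(\ell_1,\dots,\ell_n,\rho_1,\dots,\rho_n)$ is a feasible solution of the linear system (consisting of the following inequalities for all $x,y\in X$) $$ \begin{array}{rcll} \ell_x+\rho_x+1&\leq& \ell_y & \text{if } (x,y) \text{ is a slack zero cover pair},\\ \ell_x&\leq& \ell_y+\rho_y & \text{if } (x,y) \text{ is a sharp pair},\\ -\rho_x&\leq& 0 & \text{if } (x,x) \text{ is a slack zero pair}, \end{array} $$ if and only if $\ell_i\ge 0$ for $1\le i\le n$, and the length vector $(\rho_1,\dots,\rho_n)$ is a feasible solution of the system of all cycle inequalities of the key graph $G_P$.
   Context: A finite (strictly) partially ordered set $P=(X,\prec)$ is an interval order if there are compact real intervals $[\ell_x,r_x]$, $x\in X$, with $\ell_x\le r_x$, such that $x\prec y$ if and only if $r_x<\ell_y$. Interval representations are moreover required to satisfy $r_x+1\le \ell_y$ for all $x\prec y$. The length of the interval of $x$ is $\rho_x=r_x-\ell_x$. A natural representation is one in which all endpoints are non-negative integers. The magnitude $m$ of $P$ is the number of distinct down-sets $D(z)=\{x\in X: x\prec z\}$, $z\in X$. The canonical representation $\{[\ell_x^*,r_x^*]:x\in X\}$ of $P$ is the (unique) natural representation whose set of interval endpoints is $\{0,1,\dots,m-1\}$. For $x,y\in X$: $(x,x)$ is a slack zero pair if $\ell_x^*=r_x^*$; $(x,y)$ is a slack zero cover pair if $\ell_y^*=r_x^*+1$; $(x,y)$ is a sharp pair if $x\ne y$ and $\ell_x^*=r_y^*$.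 The key graph $G_P$ is the directed graph with vertices $\rho_1,\dots,\rho_n$ and with arcs coloured red or blue, each arc being weighted by an inequality: a red loop at $\rho_x$, with weight $-\rho_x\le 0$, if $(x,x)$ is a slack zero pair; a blue arc $\rho_x\to\rho_y$, with weight $\ell_x+\rho_x+1\le \ell_y$, if $(x,y)$ is a slack zero cover pair; a red arc $\rho_x\to\rho_y$, with weight $\ell_x\le\ell_y+\rho_y$, if $(x,y)$ is a sharp pair. The cycle inequality of a directed cycle of $G_P$ (no repeated vertices; a loop counts as a cycle of length one) is the inequality obtained by summing the weights of its arcs; all variables $\ell_x$ cancel, so it involves only the variables $\rho_x$. Explicitly, for a cycle of length at least two it reads $\gamma+\sum_{i\in A}\rho_i\le\sum_{j\in B}\rho_j$, where $\gamma$ is the number of blue arcs of the cycle, $A$ is the set of $s$ such that both cycle arcs at $\rho_s$ (entering and leaving) are blue, and $B$ is the set of $s$ such that both are red; for a loop at $\rho_s$ it reads $0\le\rho_s$.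
   Formalization: For a fixed vector ℓ the equivalence is false (1≺2, ρ=0, ℓ=(5,0), or ℓ=(−2,−1)); what is proved is, for every ρ: some ℓ makes (ℓ,ρ) feasible iff ρ satisfies all cycle inequalities, and likewise with some ℓ having all ℓ_i≥0. *)

(* Defs.v *)
From mathcomp Require Import all_boot all_order all_algebra.
From mathcomp Require Import reals.
Set Implicit Arguments.
Unset Strict Implicit.
Unset Printing Implicit Defensive.
Import Order.TTheory GRing.Theory Num.Theory.
Local Open Scope ring_scope.

Section IntervalOrders.
Variables (R : realType) (T : finType) (prec : rel T).

Definition strict_order := irreflexive prec /\ transitive prec.

Definition interval_order :=
  strict_order /\
  exists l r : T -> R,
    (forall x, l x <= r x) /\ (forall x y, prec x y <-> r x < l y).

Definition interval_representation (l r : T -> R) :=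
  [/\ forall x, l x <= r x,
      forall x y, prec x y <-> r x < l y &
      forall x y, prec x y -> r x + 1 <= l y].

Definition natural_representation (l r : T -> nat) :=
  interval_representation (fun x => (l x)%:R) (fun x => (r x)%:R).

Definition downset (z : T) : {set T} := [set x | prec x z].

Definition magnitude : nat := #|[set downset z | z in T]|.

Definition canonical_representation (l r : T -> nat) :=
  natural_representation l r /\
  forall k : nat, (k < magnitude)%N <-> exists x, k = l x \/ k = r x.

End IntervalOrders.

Section CanonicalRepresentation.
Variables (R : realType) (T : finType) (prec : rel T).
Notation DS := [set downset prec z | z in T].

Lemma natural_representationE (l r : T -> nat) :
  natural_representation R prec l r <->
  (forall x, (l x <= r x)%N) /\ (forall x y, prec x y = (r x < l y)%N).
Proof.
split=> [[h1 h2 _]|[h1 h2]].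
  split=> [x|x y]; first by have := h1 x; rewrite ler_nat.
  by apply/idP/idP; rewrite -[(r x < _)%N](ltr_nat R); apply h2.
split=> [x|x y|x y]; rewrite ?h2.
- by rewrite ler_nat.
- by rewrite ltr_nat.
- by rewrite natr1 ler_nat.
Qed.

Lemma canonical_representation_exists : interval_order R prec ->
  exists l r, canonical_representation R prec l r.
Proof.
case=> [[irr _] [u [v [uv uvP]]]].
have chain x y : (downset prec x \subset downset prec y) ||
                 (downset prec y \subset downset prec x).
  have [h|/ltW h] := leP (u x) (u y); apply/orP; [left|right];
  apply/subsetP => z; rewrite !inE => /uvP hz; apply/uvP; exact: lt_le_trans h.
have chainP A B : A \in DS -> B \in DS -> ~~ (A \subset B) -> B \proper A.
  move=> /imsetP[x _ ->] /imsetP[y _ ->] h.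
  by rewrite properE h andbT; case/orP: (chain x y) h => // ->.
have inDS z : downset prec z \in DS by apply: imset_f.
pose L x := [set A in DS | A \proper downset prec x].
pose N (x : T) := [set A in DS | x \notin A].
have Nself x : downset prec x \in N x by rewrite inE inDS inE irr.
have N0 x : (0 < #|N x|)%N by apply/card_gt0P; exists (downset prec x).
have LN x y : ~~ prec x y -> (#|L y| < #|N x|)%N.
  move=> xy; apply: proper_card; apply/properP; split.
    apply/subsetP => A; rewrite !inE => /andP[-> /proper_sub/subsetP s] /=.
    by apply/negP => /s; rewrite inE (negbTE xy).
  by exists (downset prec y); rewrite inE inDS ?properxx //= inE.
have NL x y : prec x y -> (#|N x| <= #|L y|)%N.
  move=> xy; apply: subset_leq_card; apply/subsetP => A; rewrite !inE.
  case/andP=> AD xA; rewrite AD /= chainP //; apply/negP => /subsetP s.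
  by case/negP: xA; apply: s; rewrite inE.
exists (fun x => #|L x|), (fun x => #|N x|.-1); split.
  apply/natural_representationE; split=> [x|x y].
    by rewrite -ltnS prednK // LN // irr.
  apply/idP/idP; first by move/NL; rewrite prednK.
  by rewrite prednK //; apply: contraTT => /LN; rewrite -ltnNge.
have Lm x : (#|L x| < magnitude prec)%N.
  apply: leq_trans (LN x x _) _; first by rewrite irr.
  by apply/subset_leq_card/subsetP => A; rewrite inE => /andP[].
pose P (A : {set T}) := [set B in DS | B \proper A].
have Pinj : {in DS &, injective (fun A => #|P A|)}.
  have W A B : A \in DS -> B \in DS -> A \proper B -> (#|P A| < #|P B|)%N.
    move=> AD BD AB; apply: proper_card; apply/properP; split.
      apply/subsetP => C; rewrite !inE => /andP[-> h].
      exact: proper_trans h AB.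
    by exists A; rewrite !inE ?AD ?AB ?properxx.
  move=> A B AD BD e; apply/eqP; rewrite eqEsubset.
  apply/andP; split; apply: contraT => h.
    by have := W _ _ BD AD (chainP _ _ AD BD h); rewrite e ltnn.
  by have := W _ _ AD BD (chainP _ _ BD AD h); rewrite e ltnn.
move=> k; split=> [km|[x [->|->]]]; last 2 first.
- exact: Lm.
- rewrite prednK //; apply/subset_leq_card/subsetP => A.
  by rewrite inE => /andP[].
have [] := @uniq_min_size _ (map (fun A => #|P A|) (enum DS))
                            (iota 0 (magnitude prec)).
- rewrite map_inj_in_uniq ?enum_uniq // => A B.
  by rewrite !mem_enum; apply: Pinj.
- move=> j /mapP[A]; rewrite mem_enum => /imsetP[x _ ->] ->.
  by rewrite mem_iota; apply: Lm.
- by rewrite size_iota size_map -cardE.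
move=> _ /(_ k); rewrite mem_iota km => /mapP[A].
by rewrite mem_enum => /imsetP[x _ ->] ->; exists x; left.
Qed.

Lemma canonical_representationE (l r : T -> nat) :
  canonical_representation R prec l r ->
  forall x, l x = #|[set A in DS | A \proper downset prec x]| /\
            (r x).+1 = #|[set A in DS | x \notin A]|.
Proof.
case=> /natural_representationE[lr pE] ends.
have lm x : (l x < magnitude prec)%N by apply/ends; exists x; left.
have rm x : (r x < magnitude prec)%N by apply/ends; exists x; right.
move=> y; have x0 : T := y; move: y.
pose rep A := odflt x0 [pick z | downset prec z == A].
have repK A : A \in DS -> downset prec (rep A) = A.
  move=> /imsetP[x _ ->]; rewrite /rep; case: pickP => [z /eqP //|/(_ x)].
  by rewrite eqxx.
pose g A := l (rep A).
have dE x y : l x = l y -> downset prec x = downset prec y.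
  by move=> e; apply/setP => z; rewrite !inE !pE e.
have [] := @uniq_min_size _ (map g (enum DS)) (iota 0 (magnitude prec)).
- rewrite map_inj_in_uniq ?enum_uniq // => A B.
  by rewrite !mem_enum => AD BD /dE; rewrite !repK.
- by move=> j /mapP[A _ ->]; rewrite mem_iota; apply: lm.
- by rewrite size_iota size_map -cardE.
move=> sz gE.
have lg x : l x = g (downset prec x).
  have : l x \in map g (enum DS) by rewrite gE mem_iota; apply: lm.
  case/mapP=> A; rewrite mem_enum => AD lE; rewrite lE; congr g.
  by rewrite -(repK A AD); apply: dE.
have pg : perm_eq (map g (enum DS)) (iota 0 (magnitude prec)).
  apply: uniq_perm => //; last exact: iota_uniq.
  rewrite (@eq_uniq _ _ (iota 0 (magnitude prec))) ?iota_uniq //.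

have cnt b : (b <= magnitude prec)%N -> #|[set A in DS | (g A < b)%N]| = b.
  move=> bm; transitivity (count (fun j => j < b)%N (map g (enum DS))).
    rewrite count_map -size_filter cardE.
    apply: perm_size; apply: uniq_perm;
      [exact: enum_uniq | by apply/filter_uniq; exact: enum_uniq |].
    by move=> A; rewrite mem_enum mem_filter mem_enum !inE andbC.
  rewrite (permP pg) -[magnitude prec](subnKC bm) iotaD count_cat add0n.
  rewrite (_ : count _ (iota 0 b) = b); last first.
    rewrite (eq_in_count (a2 := predT)) ?count_predT ?size_iota // => j.
    by rewrite mem_iota.
  rewrite (_ : count _ _ = 0%N) ?addn0 //.
  rewrite (eq_in_count (a2 := pred0)) ?count_pred0 // => j.
  by rewrite mem_iota => /andP[h _]; rewrite /= ltnNge h.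
have gmono A B : A \in DS -> B \in DS -> (g A <= g B)%N -> A \subset B.
  move=> AD BD AB; rewrite -(repK A AD) -(repK B BD); apply/subsetP => z.
  by rewrite !inE !pE => h; apply: leq_trans AB.
have inDS z : downset prec z \in DS by apply: imset_f.
move=> x; split.
  rewrite -[LHS](cnt _ (ltnW (lm x))) lg.
  apply: eq_card => A; rewrite !inE; case AD: (A \in DS) => //=.
  rewrite ltnNge properE; apply/negP/andP => [h|[_ h] h'].
    split; first by apply: gmono => //; rewrite ltnW // ltnNge; apply/negP.
    apply/negP => s; apply: h; have [//|h] := leqP (g (downset prec x)) (g A).
    have e : A = downset prec x.
      by apply/eqP; rewrite eqEsubset s gmono // ltnW.
    by rewrite -e ltnn in h.
  by case/negP: h; apply: gmono.
rewrite -[LHS](cnt _ (rm x)).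
apply: eq_card => A; rewrite !inE; case AD: (A \in DS) => //=.
by rewrite -[in RHS](repK A AD) inE pE -leqNgt ltnS.
Qed.

Lemma canonical_representation_unique (l r l' r' : T -> nat) :
  canonical_representation R prec l r ->
  canonical_representation R prec l' r' -> l =1 l' /\ r =1 r'.
Proof.
move=> /canonical_representationE h /canonical_representationE h'.
split=> x; first by rewrite (h x).1 (h' x).1.
by apply: succn_inj; rewrite (h x).2 (h' x).2.
Qed.
End CanonicalRepresentation.

Section KeyGraph.
Variable T : finType.

(* In this section ls and rs are the endpoints of the canonical
   representation. *)

Definition slack_zero (ls rs : T -> nat) (x : T) : bool := ls x == rs x.

Definition slack_zero_cover (ls rs : T -> nat) (x y : T) : bool :=
  ls y == (rs x).+1.

Definition sharp (ls rs : T -> nat) (x y : T) : bool :=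
  (x != y) && (ls x == rs y).

Variant colour := Red | Blue.

Definition is_blue (c : colour) : bool := if c is Blue then true else false.

(* The vertex rho_x of the key graph is represented by x itself. *)
Record coloured_arc := Arc { source : T; target : T; arc_colour : colour }.

Definition blue (a : coloured_arc) : bool := is_blue (arc_colour a).
Definition red (a : coloured_arc) : bool := ~~ blue a.

Definition key_arc (ls rs : T -> nat) (a : coloured_arc) : bool :=
  match a with
  | Arc x y Blue => slack_zero_cover ls rs x y
  | Arc x y Red => sharp ls rs x y || (x == y) && slack_zero ls rs x
  end.

(* A directed cycle is given by its cyclic sequence of arcs; a loop is a cycle
   of length one. *)
Definition key_cycle (ls rs : T -> nat) (c : seq coloured_arc) : bool :=
  [&& 0 < size c, all (key_arc ls rs) c,
      cycle (fun a b => target a == source b) c & uniq (map source c)]%N.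

Definition both_at (p : pred coloured_arc) (c : seq coloured_arc) : {set T} :=
  [set s | has (fun a => (target a == s) && p a) c &&
           has (fun a => (source a == s) && p a) c].

Section Inequalities.
Variable R : realType.

(* For a red loop at s, both cycle arcs at s are that loop, so this reads
   0 <= rho s. *)
Definition cycle_inequality (rho : T -> R) (c : seq coloured_arc) : Prop :=
  (count blue c)%:R + \sum_(s in both_at blue c) rho s
    <= \sum_(s in both_at red c) rho s.

Definition cycle_system (ls rs : T -> nat) (rho : T -> R) : Prop :=
  forall c, key_cycle ls rs c -> cycle_inequality rho c.

Definition key_system (ls rs : T -> nat) (l rho : T -> R) : Prop :=
  forall x y : T,
    [/\ slack_zero_cover ls rs x y -> l x + rho x + 1 <= l y,
        sharp ls rs x y -> l x <= l y + rho y &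
        slack_zero ls rs x -> - rho x <= 0].

(* The weight of the arc a is weight_lhs a <= weight_rhs a. *)
Definition weight_lhs (l rho : T -> R) (a : coloured_arc) : R :=
  match a with
  | Arc x y Blue => l x + rho x + 1
  | Arc x y Red => if x == y then - rho x else l x
  end.

Definition weight_rhs (l rho : T -> R) (a : coloured_arc) : R :=
  match a with
  | Arc x y Blue => l y
  | Arc x y Red => if x == y then 0 else l y + rho y
  end.

End Inequalities.
End KeyGraph.

Section SumOfWeights.
Variables (R : realType) (T : finType).
Implicit Types (c : seq (coloured_arc T)) (f : coloured_arc T -> T) (p : pred (coloured_arc T)).

Lemma cycle_targets c : cycle (fun a b => target a == source b) c ->
  map (@target T) c = rot 1 (map (@source T) c).
Proof.
case: c => // a c h; rewrite [map _ (a :: c) in RHS]/= rot1_cons -map_rcons.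
move: h; rewrite /=.
have H : forall x s, path (fun a b : coloured_arc T => target a == source b) x s ->
    map (@target T) (belast x s) = map (@source T) s.
  by move=> x s; elim: s x => //= y s IH x /andP[/eqP -> /IH ->].
by move=> /H; rewrite belast_rcons.
Qed.

Lemma has_mapE f p c s :
  has (fun a => (f a == s) && p a) c = (s \in map f (filter p c)).
Proof.
elim: c => //= a c ->; case: (p a); rewrite ?andbF ?andbT //=.
by rewrite in_cons eq_sym.
Qed.

Lemma big_has f p c (F : T -> R) : uniq (map f c) ->
  \sum_(a <- c | p a) F (f a) =
  \sum_(s | has (fun a => (f a == s) && p a) c) F s.
Proof.
move=> u; rewrite -big_filter -(big_map f xpredT F) big_uniq /=; last first.
  by apply: subseq_uniq u; rewrite filter_mask; apply/subseqP; exists (map p c);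
     rewrite ?size_map // map_mask.
by apply: eq_bigl => s; rewrite has_mapE.
Qed.

Lemma has_notin f p c s : s \notin map f c ->
  has (fun a => (f a == s) && p a) c = false.
Proof.
by elim: c => //= a c IH; rewrite in_cons negb_or eq_sym => /andP[/negbTE-> /IH].
Qed.

Lemma has_compl f p c s : uniq (map f c) -> s \in map f c ->
  has (fun a => (f a == s) && ~~ p a) c = ~~ has (fun a => (f a == s) && p a) c.
Proof.
elim: c => //= a c IH /andP[na u]; rewrite in_cons eq_sym.
have [<- _|_ /= h] := eqVneq (f a) s; last exact: IH.
by rewrite !has_notin //; case: (p a).
Qed.

(* Summing the weights of the arcs of a cycle cancels every l x and leaves the
   cycle inequality. *)
Lemma cycle_inequalityE (ls rs : T -> nat) (l rho : T -> R) c :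
  key_cycle ls rs c ->
  cycle_inequality rho c <->
  \sum_(a <- c) weight_lhs l rho a <= \sum_(a <- c) weight_rhs l rho a.
Proof.
case/and4P=> _ _ cyc us.
have tE := cycle_targets cyc.
have ut : uniq (map (@target T) c) by rewrite tE rot_uniq.
have memt s : (s \in map (@target T) c) = (s \in map (@source T) c).
  by rewrite tE mem_rot.
have lE : \sum_(a <- c) l (target a) = \sum_(a <- c) l (source a).
  rewrite -(big_map (@target T) xpredT l) -(big_map (@source T) xpredT l) tE.
  by apply: perm_big; rewrite perm_rot perm_refl.
pose O p s := has (fun a : coloured_arc T => (source a == s) && p a) c.
pose I p s := has (fun a : coloured_arc T => (target a == s) && p a) c.
have OI s : O (@blue T) s && ~~ I (@blue T) s = I (@red T) s && ~~ O (@red T) s.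
  have [sc|sc] := boolP (s \in map (@source T) c).
    rewrite /O /I /red !has_compl ?memt // negbK andbC.
    by [].
  by rewrite /O /I !has_notin ?memt.
have -> : (\sum_(a <- c) weight_lhs l rho a <= \sum_(a <- c) weight_rhs l rho a)
    = (\sum_(a <- c | blue a) (rho (source a) + 1) <=
       \sum_(a <- c | red a) rho (target a)).
  rewrite -subr_ge0 -[RHS]subr_ge0 -!sumrB; congr (0 <= _).
  rewrite (big_mkcond (@red T)) (big_mkcond (@blue T)) -sumrB /=.
  transitivity (\sum_(a <- c) ((l (target a) - l (source a)) +
     ((if red a then rho (target a) else 0) -
      (if blue a then rho (source a) + 1 else 0)))); last first.
    by rewrite big_split /= sumrB lE subrr add0r.
  apply: eq_bigr => -[x y []] _ /=; rewrite /red /blue /=.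
    by case: eqP => [->|_]; rewrite !subr0 ?subrr ?add0r ?opprK // addrAC.
  by rewrite sub0r !opprD !addrA.
have bO : \sum_(a <- c | blue a) rho (source a) = \sum_(s | O (@blue T) s) rho s.
  exact: big_has.
have bI : \sum_(a <- c | red a) rho (target a) = \sum_(s | I (@red T) s) rho s.
  exact: big_has.
rewrite big_split /= bO bI /cycle_inequality.
have -> : \sum_(a <- c | blue a) (1 : R) = (count (@blue T) c)%:R.
  by rewrite big_const_seq iter_addr_0.
pose D := \sum_(s | I (@red T) s && ~~ O (@red T) s) rho s.
have -> : \sum_(s | O (@blue T) s) rho s = \sum_(s in both_at (@blue T) c) rho s + D.
  rewrite (bigID (I (@blue T))) /=; congr (_ + _).
    by apply: eq_bigl => s; rewrite inE andbC.
  by apply: eq_bigl => s; apply: OI.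
have -> : \sum_(s | I (@red T) s) rho s = \sum_(s in both_at (@red T) c) rho s + D.
  rewrite (bigID (O (@red T))) /=; congr (_ + _).
  by apply: eq_bigl => s; rewrite inE.
by rewrite addrAC lerD2r addrC.
Qed.

End SumOfWeights.

(* Main.v *)
Require Import Defs.
From mathcomp Require Import all_boot all_order all_algebra.
From mathcomp Require Import classical_sets reals.
Import Order.TTheory GRing.Theory Num.Theory.
Local Open Scope ring_scope.

(** The key system is a system of difference constraints in the unknowns [l]:
    with [rho] fixed, it asks that [l (source a) + w a <= l (target a)] for
    every arc [a] of the key graph, where [w a] is [rho x + 1] for a blue arc
    leaving [x] and [- rho y] for a red arc (or loop) entering [y].

    If [l] exists, summing these constraints along a cycle cancels [l] and
    gives the cycle inequality ([cycle_inequalityE]).  Conversely the cycle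
    inequalities say that [w] has sum at most zero on every cycle without
    repeated vertices, hence on every closed walk, since a closed walk that
    repeats a vertex splits into two shorter ones ([closed_walk_le0]).  Deleting
    closed subwalks thus never decreases the weight of a walk, so the weights
    of all walks are bounded ([walk_le]), and
      [l y = sup { weight of s : s is a walk ending at y }]
    is a solution: a walk to [source a] extends by [a] to a walk to [target a].
    It is non-negative because of the empty walks ([potential_exists]).  This
    settles the solvability with and without the condition [0 <= l]. *)

Section Walks.
Variables (A : Type) (V : finType) (src tgt : A -> V) (arc : pred A).
Implicit Types (s : seq A) (x y z : V).

(** [walk x s y]: the arcs [s] form a walk from [x] to [y], possibly empty, with
    vertices and arcs possibly repeated. *)
Fixpoint walk x s y : bool :=
  if s is a :: s' then [&& arc a, src a == x & walk (tgt a) s' y] else x == y.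

Lemma walk_cat x s1 z s2 y : walk x s1 z -> walk z s2 y -> walk x (s1 ++ s2) y.
Proof.
elim: s1 x => [|a s1 IH] x /= => [/eqP-> //|/and3P[-> -> /IH h] /h ->].
by [].
Qed.

Lemma walk_split x s1 a s2 y : walk x (s1 ++ a :: s2) y ->
  walk x s1 (src a) /\ walk (src a) (a :: s2) y.
Proof.
elim: s1 x => [|b s1 IH] x /=.
  by case/and3P=> -> /eqP-> ->; rewrite !eqxx.
by case/and3P=> -> -> /IH.
Qed.

Lemma walk_all x s y : walk x s y -> all arc s.
Proof. by elim: s x => //= a s IH x /and3P[-> _ /IH]. Qed.

Lemma closed_walk_cycle x s : walk x s x -> cycle (fun a b => tgt a == src b) s.
Proof.
case: s => // a s /= /and3P[_ /eqP <-].
have: forall b, walk (tgt b) s (src a) ->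
    path (fun a b => tgt a == src b) b (rcons s a).
  elim: s => [|c s IH] b /=; first by rewrite andbT.
  by case/and3P=> _ /eqP-> /IH->; rewrite eqxx.
by apply.
Qed.

Lemma mem_map_split s x : x \in map src s ->
  exists s1 b s2, s = s1 ++ b :: s2 /\ x = src b.
Proof.
elim: s => //= a s IH; rewrite in_cons => /predU1P[->|/IH].
  by exists [::], a, s.
by case=> s1 [b [s2 [-> xb]]]; exists (a :: s1), b, s2.
Qed.

Lemma nonuniq_map_split s : ~~ uniq (map src s) ->
  exists s1 a s2 b s3, s = s1 ++ a :: s2 ++ b :: s3 /\ src a = src b.
Proof.
elim: s => //= a s IH; rewrite negb_and negbK => /orP[].
  move=> /mem_map_split[s2 [b [s3 [-> ab]]]].
  by exists [::], a, s2, b, s3.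
move=> /IH[s1 [b [s2 [c [s3 [-> bc]]]]]].
by exists (a :: s1), b, s2, c, s3.
Qed.

Section Weights.
Variables (R : realType) (w : A -> R).

(** A walk with a repeated source contains a closed walk, whose removal leaves
    a walk with the same ends; both are shorter. *)
Lemma walk_shortcut x s y : walk x s y -> ~~ uniq (map src s) ->
  exists z c s', [/\ walk z c z, walk x s' y,
    (size c < size s)%N, (size s' < size s)%N &
    \sum_(a <- s) w a = \sum_(a <- c) w a + \sum_(a <- s') w a].
Proof.
move=> xy /nonuniq_map_split[s1 [a [s2 [b [s3 [sE ab]]]]]].
move: xy; rewrite sE => /walk_split[w1].
rewrite -cat_cons => /walk_split[w2 w3].
exists (src a), (a :: s2), (s1 ++ b :: s3); split.
- by rewrite {2}ab.
- by apply: walk_cat w1 _; rewrite ab.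
- by rewrite !size_cat /= !addnS !ltnS addnCA leq_addr.
- by rewrite !size_cat ltn_add2l /= addSn ltnS leq_addl.
- by rewrite !big_cat /= addrCA.
Qed.

Hypothesis cycle_le0 : forall c, (0 < size c)%N -> all arc c ->
  cycle (fun a b => tgt a == src b) c -> uniq (map src c) ->
  \sum_(a <- c) w a <= 0.

Lemma closed_walk_le0 x s : walk x s x -> \sum_(a <- s) w a <= 0.
Proof.
have [n] := ubnP (size s); elim: n => // n IH in x s *; rewrite ltnS => sn xx.
have [us|nus] := boolP (uniq (map src s)).
  case: (posnP (size s)) => [/size0nil->|s0]; first by rewrite big_nil.
  apply: cycle_le0 => //; [exact: walk_all xx | exact: closed_walk_cycle xx].
have [z [c [s' [zz xx' cs s's ->]]]] := walk_shortcut _ _ _ xx nus.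
rewrite -[leRHS]addr0 lerD //.
  exact: IH (leq_trans cs sn) zz.
exact: IH (leq_trans s's sn) xx'.
Qed.

Lemma walk_le (M : R) x s y : 0 <= M -> (forall a, arc a -> w a <= M) ->
  walk x s y -> \sum_(a <- s) w a <= M *+ #|V|.
Proof.
move=> M0 wM.
have [n] := ubnP (size s); elim: n => // n IH in s *; rewrite ltnS => sn xy.
have [us|nus] := boolP (uniq (map src s)).
  (* Distinct sources: the walk has at most #|V| arcs. *)
  apply: (@le_trans _ _ (M *+ size s)); last first.
    rewrite ler_wpMn2l // -(size_map src) -(card_uniqP us).
    exact: max_card.
  have := walk_all _ _ _ xy; elim: s {sn xy us} => [|a s IHs] /=.
    by rewrite big_nil.
  by case/andP=> /wM wa /IHs h; rewrite big_cons mulrS lerD.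
have [z [c [s' [zz xy' _ s's ->]]]] := walk_shortcut _ _ _ xy nus.
rewrite -[leRHS]add0r lerD //; first exact: closed_walk_le0 zz.
exact: IH (leq_trans s's sn) xy'.
Qed.

(** Feasibility of a system of difference constraints whose arc weights have
    sum at most zero on every cycle.  The set of arcs may be infinite, so an
    upper bound on their weights is required. *)
Lemma potential_exists (M : R) : (forall a, arc a -> w a <= M) ->
  exists l : V -> R, (forall y, 0 <= l y) /\
    (forall a, arc a -> l (src a) + w a <= l (tgt a)).
Proof.
move=> wM.
pose E y : set R := [set t | exists x s, walk x s y /\ t = \sum_(a <- s) w a]%classic.
have E0 y : E y 0 by exists y, [::]; rewrite big_nil /= eqxx.
have supE y : has_sup (E y).
  split; first by exists 0.
  exists (`|M| *+ #|V|) => t [x [s [xy ->]]].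
  apply: walk_le xy => // a /wM h; exact: le_trans h (ler_norm M).
exists (fun y => sup (E y)); split=> [y|a aa].
  exact: sup_upper_bound.
rewrite -lerBrDr; apply: ge_sup; first by exists 0.
move=> t [x [s [xa ->]]]; rewrite lerBrDr; apply: sup_upper_bound => //.
exists x, (rcons s a); split; last by rewrite -cats1 big_cat big_seq1.
by rewrite -cats1; apply: walk_cat xa _; rewrite /= aa !eqxx.
Qed.

End Weights.
End Walks.

Section KeySystem.
Variables (R : realType) (T : finType) (ls rs : T -> nat) (rho : T -> R).

Lemma key_system_weight (l : T -> R) a : key_system ls rs l rho ->
  key_arc ls rs a -> weight_lhs l rho a <= weight_rhs l rho a.
Proof.
case: a => x y [] h /=; have [hb hr hl] := h x y; last exact: hb.
rewrite /sharp in hr *; case: (eqVneq x y) hr => [_ _|_ hr] /=; first exact: hl.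
by rewrite orbF.
Qed.

Lemma key_system_cycle_system (l : T -> R) :
  key_system ls rs l rho -> cycle_system ls rs rho.
Proof.
move=> h c kc; apply/(cycle_inequalityE l rho kc).
case/and4P: kc => _ + _ _; elim: c => [|a c IH] /=; first by rewrite !big_nil.
case/andP=> ka /IH hc; rewrite !big_cons lerD //.
exact: key_system_weight.
Qed.

(** The constant [w a] for which the weight of the arc [a] reads
    [l (source a) + w a <= l (target a)]; red loops need no separate case. *)
Definition arc_weight (a : coloured_arc T) : R :=
  if blue a then rho (source a) + 1 else - rho (target a).

Lemma arc_weightE a :
  arc_weight a = weight_lhs (fun=> 0) rho a - weight_rhs (fun=> 0) rho a.
Proof.
case: a => x y [] /=; rewrite /arc_weight /blue /=.
  by case: eqP => [->|_]; rewrite ?subr0 // !add0r.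
by rewrite add0r subr0.
Qed.

Lemma arc_weight_le a : arc_weight a <= \sum_x `|rho x| + 1.
Proof.
have rho_le x : `|rho x| <= \sum_x `|rho x|.
  by rewrite (bigD1 x) //= lerDl sumr_ge0.
rewrite /arc_weight; case: ifP => _.
  by rewrite lerD2r (le_trans (ler_norm _)).
rewrite -[leLHS]addr0 lerD // (le_trans (ler_norm _)) // normrN //.
Qed.

Lemma cycle_system_solution : cycle_system ls rs rho ->
  exists l : T -> R, (forall x, 0 <= l x) /\ key_system ls rs l rho.
Proof.
move=> cs.
have [|l [l0 lP]] := potential_exists _ _ (@source T) (@target T)
  (key_arc ls rs) R arc_weight _ _ (fun a _ => arc_weight_le a).
  (* With [l = 0] the summed weights of a cycle are the cycle inequality. *)
  move=> c c0 ac cc uc.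
  have kc : key_cycle ls rs c by apply/and4P.
  have /(cycle_inequalityE (fun=> 0) rho kc) := cs c kc.
  by rewrite -subr_le0 -sumrB (eq_bigr _ (fun a _ => arc_weightE a)).
exists l; split=> // x y; split=> [b|s|z].
- by have := lP (Arc x y Blue) b; rewrite /= addrA.
- have := lP (Arc x y Red); rewrite /= s => /(_ isT).
  by rewrite lerBlDr.
- have := lP (Arc x x Red); rewrite /= eqxx z orbT => /(_ isT).
  by rewrite gerDl.
Qed.

End KeySystem.

Theorem proposition5p3 (R : realType) (n : nat) (prec : rel 'I_n)
    (ls rs : 'I_n -> nat) :
  interval_order R prec ->
  canonical_representation R prec ls rs ->
  forall rho : 'I_n -> R,
    ((exists l : 'I_n -> R, key_system ls rs l rho)
       <-> cycle_system ls rs rho) /\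
    ((exists l : 'I_n -> R, (forall i, 0 <= l i) /\ key_system ls rs l rho)
       <-> cycle_system ls rs rho).
Proof.
move=> _ _ rho; split; split=> [[l]|/cycle_system_solution[l [l0 h]]].
- exact: key_system_cycle_system.
- by exists l.
- by case=> _; apply: key_system_cycle_system.
- by exists l.
Qed.
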